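(* Let $G\subset \mathrm{GL}(n)$ be a matrix Lie group with Lie algebra $\mathfrak g\subset\mathbb R^{n\times n}$, and let $(g(t),\xi(t))\in G\times\mathfrak g$, $0\le t<\infty$, be an arbitrary trajectory of $\dot g=g\xi$. Assume: (1) $A(t)=g(t)^{-1}F$ for all $t\ge 0$, where $F\in\mathbb R^{n\times n}$ is a constant invertible matrix; (2) $\xi_{\rm m}(t)=\xi(t)+b$ for all $t\ge0$, where $b\in\mathfrak g$ is constant; (3) there are constants $B_\xi>0$, $B_b>0$ with $\|\xi(t)\|\le B_\xi$ for all $t\ge 0$ and $\|b\|\le B_b$, and there are numbers $L_g>0$, $U_g>0$ with $L_g\le\sigma_{\min}(g(t))\le\sigma_{\max}(g(t))\le U_g$ for all $t\ge0$. Consider the observer with state $(\bar A,\bar b)\in\mathbb R^{n\times n}\times\mathfrak g$ given by $$\dot{\bar A}=-\xi_{\rm m}\bar A+\bar b A+k_P(A-\bar A),\qquad \dot{\bar b}=k_I\,\pi_{\mathfrak g}\big((A-\bar A)A^{-1}\big),$$ and let $E_A=A-\bar A$, $e_b=b-\bar b$. Then for any $k_P>2B_\xi+B_b$ and $k_I>0$ there exist numbers $a>0$ and $C>0$ such that $$\|E_A(t)\|+\|e_b(t)\|\le C\big(\|E_A(0)\|+\|e_b(0)\|\big)e^{-at}$$ for all $t\ge0$ and all initial conditions $(\bar A(0),\bar b(0))\in\mathbb R^{n\times n}\times\mathfrak g$ (with $a$, $C$ not depending on the initial condition).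
   Context: $\mathrm{GL}(n)=\{A\in\mathbb R^{n\times n}\mid\det A\ne0\}$; the Lie algebra $\mathfrak g$ of $G$ is regarded as a Lie subalgebra of $\mathbb R^{n\times n}$ with the matrix commutator. $\langle A,B\rangle=\operatorname{tr}(A^TB)$ is the Euclidean inner product on $\mathbb R^{n\times n}$, and $\|A\|=\sqrt{\langle A,A\rangle}$ is the Frobenius norm. $\pi_{\mathfrak g}:\mathbb R^{n\times n}\to\mathfrak g$ is the orthogonal projection onto $\mathfrak g$ with respect to $\langle\cdot,\cdot\rangle$. $\sigma_{\min}(\cdot)$ and $\sigma_{\max}(\cdot)$ denote the minimum and maximum singular values. *)

(* Defs.v *)
From HB Require Import structures.
From mathcomp Require Import all_boot all_order all_algebra.
From mathcomp Require Import all_classical all_reals all_analysis.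

Set Implicit Arguments.
Unset Strict Implicit.
Unset Printing Implicit Defensive.

Import Order.TTheory GRing.Theory Num.Theory.
Import numFieldNormedType.Exports.

Local Open Scope classical_set_scope.
Local Open Scope ring_scope.

Section MatrixLieGroups.
Context {R : realType} {n : nat}.
Implicit Types (A B M P X : 'M[R]_n) (G V : set 'M[R]_n).

Definition GL : set 'M[R]_n := [set A | \det A != 0].

(* A subgroup of GL(n) that is closed in GL(n), not necessarily in 'M_n. *)
Definition matrix_lie_group G : Prop :=
  [/\ G `<=` GL,
      G 1%:M,
      (forall A B, G A -> G B -> G (A *m B)),
      (forall A, G A -> G (invmx A)) &
      closure G `&` GL `<=` G].

(* The tangent space of G at the identity: velocities of curves in G. *)
Definition lie_algebra G : set 'M[R]_n :=
  [set X | exists gamma : R -> 'M[R]_n,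
    [/\ (forall t, G (gamma t)),
        (forall t, derivable gamma t 1),
        gamma 0 = 1%:M &
        is_derive (0 : R) (1 : R) gamma X]].

Definition mxdot A B : R := \tr (A^T *m B).

(* The library's norm `|A| on 'M_n is the maximum of the entries' absolute
   values, not this one; both induce the same topology. *)
Definition frobenius A : R := Num.sqrt (mxdot A A).

(* For a linear subspace V the set below is a singleton; the default 0 is
   only used where there is no orthogonal projection. *)
Definition orthogonal_projection V M : 'M[R]_n :=
  xget 0 [set P | V P /\ forall X, V X -> mxdot (M - P) X = 0].

Definition singular_values M : set R :=
  [set s | 0 <= s /\ eigenvalue (M^T *m M) (s ^+ 2)].

(* For 0 < n, singular_values M is finite and nonempty, so that inf and sup
   are its minimum and maximum. *)
Definition sigma_min M : R := inf (singular_values M).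
Definition sigma_max M : R := sup (singular_values M).

(* f is differentiable at t as a function on [0, +oo[, with derivative D:
   two-sided for t > 0, right-sided at t = 0. *)
Definition is_derive_ge0 (f : R -> 'M[R]_n) (t : R) (D : 'M[R]_n) : Prop :=
  h^-1 *: (f (h + t) - f t) @[h --> within [set h | 0 <= h + t] 0^'] --> D.

End MatrixLieGroups.

Arguments GL : clear implicits.

(* Main.v *)
Require Import Defs.
From HB Require Import structures.
From mathcomp Require Import all_boot all_order all_algebra.
From mathcomp Require Import all_classical all_reals all_analysis.
From mathcomp Require Import ring lra.

Set Implicit Arguments.
Unset Strict Implicit.
Unset Printing Implicit Defensive.

Import Order.TTheory GRing.Theory Num.Theory.
Import numFieldNormedType.Exports.

Local Open Scope classical_set_scope.
Local Open Scope ring_scope.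

(** The observer error becomes a linear system once it is written for
    [Z = E_A A^-1 = 1 - Abar A^-1] instead of [E_A].  Since [A^-1 = F^-1 g],
    the dynamics give, with [e = b - bbar],
      [Z' = e + Y],  [Y = - (xi + b) Z - k_P Z + Z xi],
      [e' = - k_I P(Z)],
    [P] being the orthogonal projection onto the Lie algebra
    ([observer_error_dynamics]).  By the Cauchy-Schwarz inequality
    [<Z, Y> <= - c |Z|^2] with [c = k_P - (2 B_xi + B_b) > 0]
    ([mxdot_error_drift]).  As [e] lies in the Lie algebra, [<P(Z), e> = <Z, e>],
    so that the cross terms cancel in the derivative of [|Z|^2 + |e|^2 / k_I],
    which is therefore bounded by [- 2 c |Z|^2].  This has no decay in [e]; the
    function
      [W = |Z|^2 / 2 + |e|^2 / (2 k_I) - eps <Z, e>]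
    has one, because the derivative of [- <Z, e>] contains [- |e|^2].  For
    [eps] small, [W] is equivalent to [|Z|^2 + |e|^2] ([lyapunov_equiv]) and
    [W' <= - a W] ([lyapunov_dissipation]); this is [error_system_decay], where
    the constants depend only on [k_I], [c] and a bound on [Y].

    To return from [Z] to [E_A = Z A], the norms of [A = g^-1 F] and
    [A^-1 = F^-1 g] have to be bounded.  The extrema of the Rayleigh quotient of
    [g^T g] on the compact unit sphere are squares of singular values, whence
    [|g| <= sqrt n sigma_max(g)] and [sigma_min(g) |g^-1| <= sqrt n].

    The projection exists because the Lie algebra is a linear subspace: the
    product of two curves in the group has the sum of the velocities, and a
    curve run at speed [c] has [c] times its velocity. *)

(** * The Frobenius inner product and norm *)

(** With [p = sum f g] and [q = sum g^2], the sum of the squares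
    [(q f_i - p g_i)^2] equals [q] times the difference of the two sides. *)
Lemma sqr_sum_mul_le (R : realDomainType) (I : finType) (f g : I -> R) :
  (\sum_i f i * g i) ^+ 2 <= (\sum_i f i ^+ 2) * (\sum_i g i ^+ 2).
Proof.
set p := \sum_i f i * g i; set q := \sum_i g i ^+ 2.
have q_ge0 : 0 <= q by apply: sumr_ge0 => i _; exact: sqr_ge0.
have key : 0 <= q * ((\sum_i f i ^+ 2) * q - p ^+ 2).
  suff -> : q * ((\sum_i f i ^+ 2) * q - p ^+ 2) =
            \sum_i (q * f i - p * g i) ^+ 2.
    by apply: sumr_ge0 => i _; exact: sqr_ge0.
  under [RHS]eq_bigr => i _.
    rewrite (_ : _ ^+ 2 = q ^+ 2 * f i ^+ 2 - (2 * q * p) * (f i * g i)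
                          + p ^+ 2 * g i ^+ 2); last by ring.
    over.
  rewrite !big_split/= sumrN -!mulr_sumr -/p -/q; ring.
have [q0|q_neq0] := eqVneq q 0; last first.
  have q_gt0 : 0 < q by rewrite lt_def q_neq0.
  by rewrite -subr_ge0 -(pmulr_rge0 _ q_gt0).
suff -> : p = 0 by rewrite expr0n/= mulr_ge0// sumr_ge0// => i _; exact: sqr_ge0.
apply: big1 => i _.
have : g i ^+ 2 <= q by rewrite /q (bigD1 i)//= lerDl sumr_ge0// => j _; exact: sqr_ge0.
rewrite q0 => g0; have /eqP : g i ^+ 2 = 0 by apply/eqP; rewrite eq_le g0 sqr_ge0.
by rewrite sqrf_eq0 => /eqP->; rewrite mulr0.
Qed.

Section FrobeniusInnerProduct.
Context {R : realType} {n : nat}.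
Implicit Types A B X Y Z : 'M[R]_n.

Lemma mxdotE A B : mxdot A B = \sum_i \sum_j A i j * B i j.
Proof.
rewrite /mxdot /mxtrace exchange_big/=; apply: eq_bigr => j _.
by rewrite mxE; apply: eq_bigr => i _; rewrite mxE.
Qed.

Lemma mxdotC A B : mxdot A B = mxdot B A.
Proof. by rewrite /mxdot -mxtrace_tr trmx_mul trmxK. Qed.

Lemma mxdotDr A X Y : mxdot A (X + Y) = mxdot A X + mxdot A Y.
Proof. by rewrite /mxdot mulmxDr mxtraceD. Qed.

Lemma mxdotZr (c : R) A X : mxdot A (c *: X) = c * mxdot A X.
Proof. by rewrite /mxdot -scalemxAr mxtraceZ. Qed.

Lemma mxdotNr A X : mxdot A (- X) = - mxdot A X.
Proof. by rewrite -scaleN1r mxdotZr mulN1r. Qed.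

Lemma mxdotDl A X Y : mxdot (X + Y) A = mxdot X A + mxdot Y A.
Proof. by rewrite !(mxdotC _ A) mxdotDr. Qed.

Lemma mxdotZl (c : R) A X : mxdot (c *: X) A = c * mxdot X A.
Proof. by rewrite !(mxdotC _ A) mxdotZr. Qed.

Lemma mxdotNl A X : mxdot (- X) A = - mxdot X A.
Proof. by rewrite !(mxdotC _ A) mxdotNr. Qed.

Lemma mxdot_ge0 A : 0 <= mxdot A A.
Proof. by rewrite mxdotE; do 2 (apply: sumr_ge0 => ? _); rewrite -expr2 sqr_ge0. Qed.

Lemma frobenius_ge0 A : 0 <= frobenius A.
Proof. exact: sqrtr_ge0. Qed.

Lemma sqr_frobenius A : frobenius A ^+ 2 = mxdot A A.
Proof. by rewrite sqr_sqrtr// mxdot_ge0. Qed.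

Lemma mxdot_CauchySchwarz A B : `|mxdot A B| <= frobenius A * frobenius B.
Proof.
rewrite -ler_sqr ?nnegrE ?mulr_ge0 ?frobenius_ge0// real_normK ?num_real//.
rewrite exprMn !sqr_frobenius !mxdotE !pair_big/=.
have := sqr_sum_mul_le (fun p : 'I_n * 'I_n => A p.1 p.2) (fun p => B p.1 p.2).
by under [X in _ <= X * _]eq_bigr do rewrite expr2;
   under [X in _ <= _ * X]eq_bigr do rewrite expr2.
Qed.

Lemma frobeniusN A : frobenius (- A) = frobenius A.
Proof. by rewrite /frobenius mxdotNl mxdotNr opprK. Qed.

Lemma frobeniusZ (c : R) A : 0 <= c -> frobenius (c *: A) = c * frobenius A.
Proof.
by move=> c_ge0; rewrite /frobenius mxdotZl mxdotZr mulrA -expr2 sqrtrM ?sqr_ge0// sqrtr_sqr ger0_norm.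
Qed.

Lemma frobeniusD A B : frobenius (A + B) <= frobenius A + frobenius B.
Proof.
rewrite -ler_sqr ?nnegrE ?addr_ge0 ?frobenius_ge0//.
rewrite sqrrD !sqr_frobenius mxdotDl !mxdotDr (mxdotC B).
have := le_trans (ler_norm _) (mxdot_CauchySchwarz A B); lra.
Qed.

(** Each entry of the product is a sum of products, to which the
    Cauchy-Schwarz inequality for finite sums applies. *)
Lemma frobeniusM A B : frobenius (A *m B) <= frobenius A * frobenius B.
Proof.
rewrite -ler_sqr ?nnegrE ?mulr_ge0 ?frobenius_ge0//.
rewrite exprMn !sqr_frobenius !mxdotE mulr_suml; apply: ler_sum => i _.
rewrite exchange_big/= mulr_sumr; apply: ler_sum => j _.
by rewrite -expr2 mxE (le_trans (sqr_sum_mul_le _ _))// !(eq_bigr _ (fun _ _ => expr2 _)).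
Qed.

End FrobeniusInnerProduct.

(** * Rayleigh quotients and singular values *)

Section RayleighQuotient.
Context {R : realType} {n : nat}.
Implicit Types (S g : 'M[R]_n) (v w : 'rV[R]_n).

Lemma sqr_rowE v : (v *m v^T) 0 0 = \sum_i v 0 i ^+ 2.
Proof. by rewrite mxE; apply: eq_bigr => i _; rewrite mxE expr2. Qed.

Lemma sqr_row_ge0 v : 0 <= (v *m v^T) 0 0.
Proof. by rewrite sqr_rowE sumr_ge0// => i _; exact: sqr_ge0. Qed.

Lemma sqr_row_eq0 v : (v *m v^T) 0 0 = 0 -> v = 0.
Proof.
rewrite sqr_rowE => /eqP; rewrite psumr_eq0; last by move=> i _; exact: sqr_ge0.
move=> /allP v0; apply/rowP => i; rewrite mxE; apply/eqP.
by rewrite -sqrf_eq0; exact: v0 (mem_index_enum i).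
Qed.

Lemma sqr_row_gt0 v : v != 0 -> 0 < (v *m v^T) 0 0.
Proof.
move=> v_neq0; rewrite lt_def sqr_row_ge0 andbT.
by apply: contra v_neq0 => /eqP/sqr_row_eq0->.
Qed.

Lemma continuous_quadratic_form S : continuous (fun v => (v *m S *m v^T) 0 0).
Proof.
suff -> : (fun v => (v *m S *m v^T) 0 0) =
          (fun v => \sum_j \sum_i v 0 i * S i j * v 0 j).
  apply: continuous_big => [|j _]; first exact: add_continuous.
  apply: continuous_big => [|i _ v]; first exact: add_continuous.
  have coord k : {for v, continuous (fun w : 'rV[R]_n => w 0 k)}.
    exact: coord_continuous.
  have cst_cont : {for v, continuous (fun=> S i j : R)} by exact: cst_continuous.
  exact: (continuousM (continuousM (coord i) cst_cont) (coord j)).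
apply/funext => v; rewrite mxE; apply: eq_bigr => j _.
by rewrite !mxE mulr_suml; apply: eq_bigr => i _.
Qed.

Lemma compact_unit_sphere : compact [set v : 'rV[R]_n | (v *m v^T) 0 0 = 1].
Proof.
apply: bounded_closed_compact.
  exists 1; split; first exact: num_real.
  move=> M M_gt1 v /= v1; apply: le_trans (ltW M_gt1).
  rewrite /Num.Def.normr/= mx_normrE (bigmax_le _ ler01)//= => -[i j] _ /=.
  rewrite -(@expr_le1 _ 2)// real_normK ?num_real// ord1 -v1 sqr_rowE.
  by rewrite (bigD1 j)//= lerDl sumr_ge0// => k _; exact: sqr_ge0.
apply: (@preimage_closed _ _ (fun v => (v *m v^T) 0 0) [set x | x = 1]) => [v _|].
  have := @continuous_quadratic_form 1%:M v.
  by under eq_fun do rewrite mulmx1.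
exact: closed_eq.
Qed.

(** At [t = - a / (|b| + 1)] the linear term outweighs the quadratic one. *)
Lemma nonneg_quadratic_linear_coef (a b : R) :
  (forall t : R, 0 <= 2 * t * a + t ^+ 2 * b) -> a = 0.
Proof.
move=> pos; apply/eqP/negPn/negP => a_neq0.
have a2_gt0 : 0 < a ^+ 2 by rewrite exprn_even_gt0.
have B_gt0 : 0 < `|b| + 1 by rewrite ltr_wpDl.
have := pos (- (a / (`|b| + 1))).
rewrite (_ : _ + _ = - (a ^+ 2 * (2 * (`|b| + 1) - b) / (`|b| + 1) ^+ 2)); last first.
  by field; rewrite lt0r_neq0.
rewrite oppr_ge0 leNgt divr_gt0 ?exprn_gt0// mulr_gt0//.
have := ler_norm b; have := normr_ge0 b; lra.
Qed.

(** The form is nonnegative at [v + t (v S)] for all [t], and its linear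
    coefficient in [t] is [2 |v S|^2]. *)
Lemma psd_isotropic_ker S v : S^T = S ->
  (forall w, 0 <= (w *m S *m w^T) 0 0) -> (v *m S *m v^T) 0 0 = 0 -> v *m S = 0.
Proof.
move=> S_sym S_psd v_iso; set w := v *m S.
apply: sqr_row_eq0.
have wv : w *m v^T = v *m (S *m v^T) by rewrite /w mulmxA.
have S_v : (w *m S *m v^T) 0 0 = (w *m w^T) 0 0.
  by rewrite /w trmx_mul S_sym !mulmxA.
apply: (@nonneg_quadratic_linear_coef _ ((w *m S *m w^T) 0 0)) => t.
suff -> : 2 * t * (w *m w^T) 0 0 + t ^+ 2 * (w *m S *m w^T) 0 0 =
          ((v + t *: w) *m S *m (v + t *: w)^T) 0 0 by [].
have -> : (v + t *: w) *m S *m (v + t *: w)^T =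
    v *m S *m v^T + t *: (w *m w^T) + t *: (w *m S *m v^T)
    + t ^+ 2 *: (w *m S *m w^T).
  rewrite linearD linearZ/= !mulmxDl !mulmxDr -!scalemxAl -!scalemxAr scalerA.
  by rewrite -/w -expr2 !addrA.
have entryE X1 X2 X3 X4 (c1 c2 c3 : R) :
    (X1 + c1 *: X2 + c2 *: X3 + c3 *: X4 : 'M[R]_1) 0 0 =
    X1 0 0 + c1 * X2 0 0 + c2 * X3 0 0 + c3 * X4 0 0 by rewrite !mxE.
by rewrite entryE v_iso S_v; ring.
Qed.

(** The maximum [lam] of the form on the unit sphere is attained at some [v];
    then [lam - S] is positive semidefinite and vanishes at [v], so that [v] is
    in its kernel. *)
Lemma rayleigh_max S : (0 < n)%N -> S^T = S ->
  exists2 lam, eigenvalue S lam &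
    forall v, (v *m S *m v^T) 0 0 <= lam * (v *m v^T) 0 0.
Proof.
move=> n_gt0 S_sym.
have [|v /set_mem/= v1 v_max] := EVT_max_rV _ compact_unit_sphere
    (continuous_subspaceT (@continuous_quadratic_form S)).
  exists (delta_mx 0 (Ordinal n_gt0)) => /=.
  by rewrite trmx_delta mul_delta_mx !mxE !eqxx.
set lam := (v *m S *m v^T) 0 0 in v_max.
have bound w : (w *m S *m w^T) 0 0 <= lam * (w *m w^T) 0 0.
  have [->|w_neq0] := eqVneq w 0; first by rewrite !mul0mx mxE mulr0.
  have q_gt0 := sqr_row_gt0 w_neq0; set q := (w *m w^T) 0 0 in q_gt0 *.
  have s_neq0 : Num.sqrt q != 0 by rewrite gt_eqF// sqrtr_gt0.
  have scaleE M : (((Num.sqrt q)^-1 *: w) *m M *m ((Num.sqrt q)^-1 *: w)^T) 0 0 =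
                  (w *m M *m w^T) 0 0 / q.
    rewrite linearZ/= -!scalemxAl -scalemxAr scalerA mxE.
    by rewrite -expr2 exprVn sqr_sqrtr ?ltW// mulrC.
  have := v_max ((Num.sqrt q)^-1 *: w).
  rewrite scaleE ler_pdivrMr//; apply; apply/mem_set => /=.
  by have := scaleE 1%:M; rewrite !mulmx1 divff// gt_eqF.
exists lam => //; apply/eigenvalueP; exists v; last first.
  apply: contraTneq (ltr01 : 0 < 1 :> R) => v0.
  by rewrite -v1 v0 mul0mx mxE ltxx.
have T_form w : (w *m (lam%:M - S) *m w^T) 0 0 =
                lam * (w *m w^T) 0 0 - (w *m S *m w^T) 0 0.
  by rewrite mulmxBr mulmxBl mul_mx_scalar -scalemxAl !mxE.
apply/esym/eqP; rewrite -subr_eq0 -mul_mx_scalar -mulmxBr; apply/eqP.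
apply: psd_isotropic_ker.
- by rewrite linearB/= tr_scalar_mx S_sym.
- by move=> w; rewrite T_form subr_ge0.
- by rewrite T_form v1 mulr1 subrr.
Qed.

Lemma rayleigh_min S : (0 < n)%N -> S^T = S ->
  exists2 mu, eigenvalue S mu &
    forall v, mu * (v *m v^T) 0 0 <= (v *m S *m v^T) 0 0.
Proof.
move=> n_gt0 S_sym.
have [|lam /eigenvalueP[v v_eig v_neq0] bound] := @rayleigh_max (- S) n_gt0.
  by rewrite linearN/= S_sym.
exists (- lam).
  by apply/eigenvalueP; exists v => //; rewrite scaleNr -v_eig mulmxN opprK.
move=> w; have := bound w; rewrite mulmxN mulNmx mxE; lra.
Qed.

Lemma gram_form g v : v *m (g^T *m g) *m v^T = (v *m g^T) *m (v *m g^T)^T.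
Proof. by rewrite trmx_mul trmxK !mulmxA. Qed.

Lemma sym_gram g : (g^T *m g)^T = g^T *m g.
Proof. by rewrite trmx_mul trmxK. Qed.

Lemma eigenvalue_gram_ge0 g lam : eigenvalue (g^T *m g) lam -> 0 <= lam.
Proof.
move=> /eigenvalueP[v v_eig v_neq0].
rewrite -(pmulr_lge0 _ (sqr_row_gt0 v_neq0)).
have := sqr_row_ge0 (v *m g^T); rewrite -gram_form v_eig -scalemxAl.
by rewrite [X in 0 <= X]mxE.
Qed.

Lemma singular_value_sqrt g lam : eigenvalue (g^T *m g) lam ->
  singular_values g (Num.sqrt lam).
Proof.
move=> lam_eig; split; first exact: sqrtr_ge0.
by rewrite sqr_sqrtr// (eigenvalue_gram_ge0 lam_eig).
Qed.

Lemma row_form (M N : 'M[R]_n) i : (row i M *m N *m (row i M)^T) 0 0 = (M *m N *m M^T) i i.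
Proof. by rewrite -row_mul !mxE; apply: eq_bigr => j _; rewrite !mxE. Qed.

(** The squared norm of [g] is the trace of [g^T g], a sum of [n] values of the
    form on unit vectors, each at most the largest eigenvalue. *)
Lemma sqr_frobenius_le_sigma_max g : (0 < n)%N ->
  mxdot g g <= n%:R * sigma_max g ^+ 2.
Proof.
move=> n_gt0; have [lam lam_eig bound] := rayleigh_max n_gt0 (sym_gram g).
have lam_ge0 := eigenvalue_gram_ge0 lam_eig.
have sup_sv : has_sup (singular_values g).
  split; first by exists (Num.sqrt lam); exact: singular_value_sqrt.
  exists (Num.sqrt lam) => s [s_ge0 /eigenvalueP[v v_eig v_neq0]].
  rewrite -(@ler_sqr _ s) ?nnegrE ?sqrtr_ge0// sqr_sqrtr//.
  rewrite -(ler_pM2r (sqr_row_gt0 v_neq0)).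
  by apply: le_trans (bound v); rewrite v_eig -scalemxAl [X in _ <= X]mxE.
have lam_le : lam <= sigma_max g ^+ 2.
  rewrite -[lam]sqr_sqrtr// ler_sqr ?nnegrE ?sqrtr_ge0//.
    exact/sup_upper_bound/singular_value_sqrt.
  apply: le_trans (sqrtr_ge0 lam) _.
  exact/sup_upper_bound/singular_value_sqrt.
apply: (@le_trans _ _ (n%:R * lam)); last exact: ler_wpM2l.
rewrite -[n in n%:R]card_ord -sum1_card natr_sum mulr_suml.
apply: ler_sum => i _; rewrite mul1r.
have := bound (row i 1%:M); rewrite row_form mul1mx trmx1 mulmx1.
have := row_form 1%:M 1%:M i; rewrite !mulmx1 => ->.
by rewrite trmx1 mulmx1 [1%:M i i]mxE eqxx mulr1.
Qed.

Lemma sigma_min_ge0 g : (0 < n)%N -> 0 <= sigma_min g.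
Proof.
move=> n_gt0; have [mu mu_eig _] := rayleigh_min n_gt0 (sym_gram g).
apply: lb_le_inf; last by move=> s [].
by exists (Num.sqrt mu); exact: singular_value_sqrt.
Qed.

(** The form of [g^T g] takes the value 1 on each column of [g^-1], whereas it is
    at least [sigma_min(g)^2] times the squared norm of that column. *)
Lemma sqr_frobenius_inv_le_sigma_min g : (0 < n)%N -> g \in unitmx ->
  sigma_min g ^+ 2 * mxdot (invmx g) (invmx g) <= n%:R.
Proof.
move=> n_gt0 g_unit; have [mu mu_eig bound] := rayleigh_min n_gt0 (sym_gram g).
have mu_ge0 := eigenvalue_gram_ge0 mu_eig.
have le_mu : sigma_min g ^+ 2 <= mu.
  rewrite -[mu]sqr_sqrtr// ler_sqr ?nnegrE ?sqrtr_ge0 ?sigma_min_ge0//.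
  apply: ge_inf; last exact: singular_value_sqrt.
  by exists 0 => s [].
rewrite (le_trans (ler_wpM2r (mxdot_ge0 _) le_mu))//.
rewrite -[n in n%:R]card_ord -sum1_card natr_sum mulr_sumr.
apply: ler_sum => i _.
have := bound (row i (invmx g)^T); rewrite row_form trmxK.
have := row_form (invmx g)^T 1%:M i; rewrite !mulmx1 trmxK => ->.
suff -> : (invmx g)^T *m (g^T *m g) *m invmx g = 1%:M by rewrite [1%:M i i]mxE eqxx.
by rewrite !mulmxA -trmx_mul mulmxV// trmx1 mul1mx mulmxV.
Qed.

Lemma frobenius_le_sigma_max g : (0 < n)%N -> 0 <= sigma_max g ->
  frobenius g <= Num.sqrt n%:R * sigma_max g.
Proof.
move=> n_gt0 sig_ge0; rewrite -ler_sqr ?nnegrE ?frobenius_ge0 ?mulr_ge0 ?sqrtr_ge0//.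
by rewrite exprMn sqr_frobenius sqr_sqrtr// sqr_frobenius_le_sigma_max.
Qed.

Lemma frobenius_inv_le_sigma_min g : (0 < n)%N -> g \in unitmx ->
  sigma_min g * frobenius (invmx g) <= Num.sqrt n%:R.
Proof.
move=> n_gt0 g_unit.
rewrite -ler_sqr ?nnegrE ?sqrtr_ge0 ?mulr_ge0 ?frobenius_ge0 ?sigma_min_ge0//.
by rewrite exprMn sqr_frobenius sqr_sqrtr// sqr_frobenius_inv_le_sigma_min.
Qed.

End RayleighQuotient.

(** * Derivatives of matrix-valued functions *)

Section MatrixDerivatives.
Context {R : realType}.

Lemma is_derive_sum_fun k (h : 'I_k -> R -> R) (dh : 'I_k -> R) (t v : R) :
  (forall i, is_derive t v (h i) (dh i)) ->
  is_derive t v (fun x => \sum_i h i x) (\sum_i dh i).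
Proof.
move=> h_der; have := is_derive_sum h_der.
by rewrite (_ : \sum_i h i = fun x => \sum_i h i x)//; apply/funext => x; rewrite fct_sumE.
Qed.

Lemma is_deriveM_fun (f h : R -> R) (t v df dh : R) :
  is_derive t v f df -> is_derive t v h dh ->
  is_derive t v (fun x => f x * h x) (df * h t + f t * dh).
Proof.
move=> f_der h_der; apply: (is_derive_eq (is_deriveM f_der h_der)).
by rewrite addrC mulrC.
Qed.

Lemma is_derive_mxP m p (f : R -> 'M[R]_(m, p)) (t v : R) (D : 'M[R]_(m, p)) :
  is_derive t v f D <-> forall i j, is_derive t v (fun x => f x i j) (D i j).
Proof.
split=> [f_der i j|f_der].
  have [f_drv f_val] := f_der.
  apply: DeriveDef; first exact: (derivable_mxP f t v).1.
  by rewrite -f_val derive_mx// mxE.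
have f_drv : derivable f t v by apply/derivable_mxP => i j; case: (f_der i j).
apply: DeriveDef => //; rewrite derive_mx//; apply/matrixP => i j.
by rewrite mxE; case: (f_der i j).
Qed.

Lemma is_derive_mulmx m p q (f : R -> 'M[R]_(m, p)) (h : R -> 'M[R]_(p, q))
    (t v : R) (df : 'M[R]_(m, p)) (dh : 'M[R]_(p, q)) :
  is_derive t v f df -> is_derive t v h dh ->
  is_derive t v (fun x => f x *m h x) (df *m h t + f t *m dh).
Proof.
move=> /is_derive_mxP f_der /is_derive_mxP h_der; apply/is_derive_mxP => i j.
rewrite (_ : (fun x => _) = fun x => \sum_k f x i k * h x k j); last first.
  by apply/funext => x; rewrite mxE.
rewrite !mxE -big_split/=; apply: is_derive_sum_fun => k; exact: is_deriveM_fun.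
Qed.

Lemma is_derive_mxdot n (f h : R -> 'M[R]_n) (t v : R) (df dh : 'M[R]_n) :
  is_derive t v f df -> is_derive t v h dh ->
  is_derive t v (fun x => mxdot (f x) (h x)) (mxdot df (h t) + mxdot (f t) dh).
Proof.
move=> /is_derive_mxP f_der /is_derive_mxP h_der.
rewrite (_ : (fun x => _) = fun x => \sum_i \sum_j f x i j * h x i j); last first.
  by apply/funext => x; rewrite mxdotE.
rewrite !mxdotE -big_split/=; apply: is_derive_sum_fun => i.
rewrite -big_split/=; apply: is_derive_sum_fun => j; exact: is_deriveM_fun.
Qed.

Lemma is_derive_mulrl (c t : R) : is_derive t (1 : R) (fun s : R => c * s) c.
Proof. by apply: (is_derive_eq (is_deriveZ c (is_derive_id t 1))); rewrite [LHS]mulr1. Qed.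

Lemma is_derive_rescale m p (f : R -> 'M[R]_(m, p)) (c t : R) (D : 'M[R]_(m, p)) :
  is_derive (c * t) (1 : R) f D -> is_derive t (1 : R) (fun s => f (c * s)) (c *: D).
Proof.
move=> /is_derive_mxP f_der; apply/is_derive_mxP => i j.
apply: (is_derive_eq (is_derive1_comp (f_der i j) (is_derive_mulrl c t))).
by rewrite mxE mulrC.
Qed.

(** Linear continuation to the negative half-line makes the one-sided
    derivative at 0 two-sided, so that the mean value theorem and the calculus
    of derivatives apply on the closed half-line. *)
Lemma is_derive_ge0_extend n (f : R -> 'M[R]_n) (D : R -> 'M[R]_n) :
  (forall t : R, 0 <= t -> is_derive_ge0 f t (D t)) ->
  exists2 F : R -> 'M[R]_n, (forall t : R, 0 <= t -> F t = f t) &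
    forall t : R, 0 <= t -> is_derive t (1 : R) F (D t).
Proof.
move=> f_der; pose F (t : R) := if 0 <= t then f t else f 0 + t *: D 0.
have Ff (t : R) : 0 <= t -> F t = f t by rewrite /F => ->.
exists F => // t t_ge0.
suff F_lim : (fun h : R => h^-1 *: ((F \o shift t) (h *: 1) - F t)) @ 0^' --> D t.
  apply: DeriveDef; first by apply/cvg_ex; exists (D t).
  exact: cvg_lim F_lim.
apply/cvgrPdist_le => /= e e_gt0.
have /cvgrPdist_le/(_ _ e_gt0) f_near := f_der t t_ge0.
have {}f_near : \forall h \near (0:R)^', 0 <= h + t ->
    `|D t - h^-1 *: (f (h + t) - f t)| <= e by exact: f_near.
move: t_ge0; rewrite le_eqVlt => /predU1P[t0|t_gt0].
  subst t; near=> h; rewrite [h%:A]mulr1 (Ff 0)//.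
  have [h_ge0|h_lt0] := leP 0 h.
    by rewrite Ff ?addr0//; have := near f_near h; rewrite addr0; exact.
  rewrite addr0.
  rewrite /F (leNgt 0 h) h_lt0/= [f 0 + _]addrC addrK scalerA mulVf ?scale1r ?subrr ?normr0 ?ltW//.
  exact: ltr0_neq0.
near=> h; rewrite [h%:A]mulr1 (Ff t (ltW t_gt0)).
have ht : 0 <= h + t.
  rewrite -lerBlDr sub0r; have : `|h| < t by near: h; exact: dnbhs0_lt.
  by rewrite ltr_norml => /andP[/ltW].
rewrite Ff//; have := near f_near h; exact.
Unshelve. all: by end_near. Qed.

End MatrixDerivatives.

(** * Orthogonal projection onto the Lie algebra *)

(** The predicate is stated for sets, since the Lie algebra is one and need not
    be decidable. *)
Definition linear_subspace (R : realType) (U : lmodType R) (V : set U) : Prop :=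
  [/\ V 0, forall x y, V x -> V y -> V (x + y) & forall (c : R) x, V x -> V (c *: x)].

Section OrthogonalProjection.
Context {R : realType}.

(** A maximal orthonormal family [W] in [V] spans [V]: the normalized residual of
    a vector of [V] outside its span could be added to it.  The projection is
    then [x W^T W]. *)
Lemma row_subspace_projection N (V : set 'rV[R]_N) :
  linear_subspace V -> forall x, exists2 p, V p & forall y, V y -> (x - p) *m y^T = 0.
Proof.
move=> [V0 VD VZ] x.
(* Besides orthonormality of the k rows of W, only membership of all their
   combinations in V is recorded; the empty family satisfies it since V 0. *)
pose orthonormal_in k := `[< exists W : 'M[R]_(k, N),
  W *m W^T = 1%:M /\ forall u, V (u *m W) >].
have ex_k : exists k, orthonormal_in k.
  exists 0; apply/asboolP; exists 0; split; first by apply/matrixP => -[].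
  by move=> u; rewrite mulmx0.
have k_le k : orthonormal_in k -> (k <= N)%N.
  move=> /asboolP[W [WW _]]; rewrite -(mxrank1 R k) -WW.
  by rewrite (leq_trans (mxrankM_maxl _ _))// rank_leq_col.
case: (ex_maxnP ex_k k_le) => k /asboolP[W [WW VW]] k_max {ex_k k_le}.
have span y : V y -> y = y *m W^T *m W.
  move=> Vy; apply/eqP; rewrite -subr_eq0; apply/negPn/negP.
  set z := y - _ => z_neq0.
  have Vz : V z by rewrite /z -scaleN1r; apply: VD => //; exact: VZ.
  have zW : z *m W^T = 0.
    by rewrite /z mulmxBl -[_ *m W *m _]mulmxA WW mulmx1 subrr.
  have q_gt0 := sqr_row_gt0 z_neq0; set q := (z *m z^T) 0 0 in q_gt0.
  pose w := (Num.sqrt q)^-1 *: z.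
  have ww : w *m w^T = 1%:M.
    apply/matrixP => i j; rewrite !ord1 /w linearZ/= -scalemxAl -scalemxAr scalerA.
    rewrite [LHS]mxE -/q [RHS]mxE eqxx -invfM -expr2 sqr_sqrtr ?ltW// mulVf//.
    by rewrite gt_eqF.
  have wW : w *m W^T = 0 by rewrite -scalemxAl zW scaler0.
  suff : orthonormal_in (1 + k)%N by move=> /k_max; rewrite ltnn.
  apply/asboolP; exists (@col_mx R 1 k N w W); split.
    rewrite tr_col_mx mul_col_row ww wW WW.
    have -> : W *m w^T = 0 by rewrite -[W]trmxK -trmx_mul wW trmx0.
    by rewrite -scalar_mx_block.
  move=> u; rewrite -[u](@hsubmxK _ _ 1 k) mul_row_col; apply: VD => //.
  rewrite [lsubmx u]mx11_scalar mul_scalar_mx; exact/(VZ)/(VZ).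
exists (x *m W^T *m W) => // y Vy; rewrite (span _ Vy) trmx_mul mulmxA mulmxBl.
by rewrite -[_ *m W *m _]mulmxA WW mulmx1 subrr mul0mx.
Qed.

Lemma mxdot_mxvec n (A B : 'M[R]_n) : mxdot A B = (mxvec A *m (mxvec B)^T) 0 0.
Proof.
rewrite mxdotE pair_big mxE (reindex _ (curry_mxvec_bij n n))/=.
by apply: eq_bigr => -[i j] _; rewrite !mxE !mxvecE.
Qed.

Lemma orthogonal_projectionP n (V : set 'M[R]_n) :
  linear_subspace V -> forall M, V (orthogonal_projection V M) /\
    forall X, V X -> mxdot (M - orthogonal_projection V M) X = 0.
Proof.
move=> [V0 VD VZ] M.
have [|p Vp p_orth] := @row_subspace_projection _ [set x | V (vec_mx x)] _ (mxvec M).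
  split => [|x y|c x] /=; first by rewrite linear0.
    by rewrite linearD; exact: VD.
  by rewrite linearZ; exact: VZ.
apply: (@xgetPex _ 0 [set P | V P /\ forall X, V X -> mxdot (M - P) X = 0]).
exists (vec_mx p); split=> // X VX.
have := p_orth (mxvec X); rewrite /= mxvecK => /(_ VX).
rewrite -{1}[p]vec_mxK -linearB => /matrixP/(_ 0 0).
by rewrite -mxdot_mxvec [X in _ = X]mxE.
Qed.

Lemma mxdot_projection n (V : set 'M[R]_n) (M X : 'M[R]_n) :
  linear_subspace V -> V X -> mxdot (orthogonal_projection V M) X = mxdot M X.
Proof.
move=> V_lin VX; have [_ /(_ _ VX)] := orthogonal_projectionP V_lin M.
by rewrite mxdotDl mxdotNl => /eqP; rewrite subr_eq0 => /eqP.
Qed.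

(** With [P] the projection of [M], [<M, P> = |P|^2] and
    [0 <= |M - P|^2 = |M|^2 - <M, P>]. *)
Lemma mxdot_projection_le n (V : set 'M[R]_n) (M : 'M[R]_n) :
  linear_subspace V ->
  mxdot M (orthogonal_projection V M) <= mxdot M M.
Proof.
move=> V_lin; have [VP _] := orthogonal_projectionP V_lin M.
have PM := mxdot_projection M V_lin VP.
have := mxdot_ge0 (M - orthogonal_projection V M).
rewrite !(mxdotDl, mxdotDr, mxdotNl, mxdotNr) PM (mxdotC _ M) -PM; lra.
Qed.

End OrthogonalProjection.

Section LieAlgebra.
Context {R : realType} {n : nat}.
Variables (G : set 'M[R]_n).
Hypothesis G_lie : matrix_lie_group G.

Lemma lie_algebra0 : lie_algebra G 0.
Proof.
have [_ G1 _ _ _] := G_lie; exists (cst 1%:M); split => //.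
exact: is_derive_cst.
Qed.

(** The velocity at 0 of the product of two curves through the identity is the
    sum of their velocities. *)
Lemma lie_algebraD X Y : lie_algebra G X -> lie_algebra G Y -> lie_algebra G (X + Y).
Proof.
have [_ _ GM _ _] := G_lie.
move=> [f [Gf f_der f0 f'0]] [h [Gh h_der h0 h'0]].
exists (fun t => f t *m h t); split => [t|t||].
- exact: GM.
- by have [] := is_derive_mulmx (derivableP (f_der t)) (derivableP (h_der t)).
- by rewrite f0 h0 mulmx1.
- apply: (is_derive_eq (is_derive_mulmx f'0 h'0)).
  by rewrite f0 h0 mulmx1 mul1mx.
Qed.

Lemma lie_algebraZ (c : R) X : lie_algebra G X -> lie_algebra G (c *: X).
Proof.
move=> [f [Gf f_der f0 f'0]]; exists (fun t => f (c * t)); split => [t|t||].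
- exact: Gf.
- by have [] := is_derive_rescale (derivableP (f_der (c * t))).
- by rewrite mulr0.
- by apply: is_derive_rescale; rewrite mulr0.
Qed.

Lemma linear_subspace_lie_algebra : linear_subspace (lie_algebra G).
Proof. by split; [exact: lie_algebra0|exact: lie_algebraD|exact: lie_algebraZ]. Qed.

End LieAlgebra.

(** * A Lyapunov function for the linear error system *)

Section LyapunovDecay.
Context {R : realType}.

(** The function [expR (a t) * W t] has nonpositive derivative. *)
Lemma exponential_decay (W dW : R -> R) (a : R) :
  (forall t : R, 0 <= t -> is_derive t (1 : R) W (dW t)) ->
  (forall t : R, 0 <= t -> dW t <= - (a * W t)) ->
  forall t : R, 0 <= t -> W t <= W 0 * expR (- (a * t)).
Proof.
move=> W_der W_diss t t_ge0; pose U (x : R) := expR (a * x) * W x.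
have exp_der (x : R) : is_derive x (1 : R) (fun x : R => expR (a * x)) (expR (a * x) * a).
  exact: (is_derive1_comp (is_derive_expR _) (is_derive_mulrl a x)).
have U_der (x : R) : 0 <= x -> is_derive x (1 : R) U (expR (a * x) * a * W x + expR (a * x) * dW x).
  by move=> x_ge0; exact: is_deriveM_fun (exp_der x) (W_der x x_ge0).
have U_le : U t <= U 0.
  apply: (@ler0_derive1_le_cc R U 0 t) => //; rewrite ?in_itv/= ?lexx ?t_ge0//.
  - by move=> x; rewrite in_itv/= => /andP[/ltW/U_der[]].
  - move=> x; rewrite in_itv/= => /andP[/ltW x_ge0 _].
    rewrite derive1E; have [_ ->] := U_der _ x_ge0.
    rewrite -mulrA -mulrDr pmulr_rle0 ?expR_gt0//.
    by have := W_diss _ x_ge0; lra.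
  - apply: derivable_within_continuous => x; rewrite in_itv/= => /andP[x_ge0 _].
    by have [] := U_der _ x_ge0.
rewrite expRN ler_pdivlMr ?expR_gt0// mulrC.
by move: U_le; rewrite /U mulr0 expR0 mul1r.
Qed.

(** The cross term is at most [eps (z^2 + y^2) / 2], which the two bounds on
    [eps] make at most half of the diagonal terms. *)
Lemma lyapunov_equiv (k eps z y u : R) : 0 < k -> 0 <= eps -> eps <= 2^-1 ->
  eps * k <= 2^-1 -> `|u| <= z * y ->
  4^-1 * (z ^+ 2 + y ^+ 2 / k) <= z ^+ 2 / 2 + y ^+ 2 / k / 2 - eps * u <=
  3 / 4 * (z ^+ 2 + y ^+ 2 / k).
Proof.
move=> k_gt0 eps_ge0 eps_le epsk_le u_le.
set y' := y ^+ 2 / k.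
have yE : y ^+ 2 = k * y' by rewrite /y' mulrC divfK// gt_eqF.
have y'_ge0 : 0 <= y' by rewrite divr_ge0 ?sqr_ge0// ltW.
have zy : z * y <= (z ^+ 2 + y ^+ 2) / 2 by have := sqr_ge0 (z - y); rewrite sqrrB; lra.
have epsu : `|eps * u| <= eps * ((z ^+ 2 + k * y') / 2).
  by rewrite normrM ger0_norm// ler_wpM2l// -yE (le_trans u_le).
have z_le : eps * z ^+ 2 <= 2^-1 * z ^+ 2 by rewrite ler_wpM2r ?sqr_ge0.
have y_le : eps * k * y' <= 2^-1 * y' by rewrite ler_wpM2r.
move: epsu; rewrite ler_norml => /andP[epsu1 epsu2].
apply/andP; split; lra.
Qed.

(** The left side is the derivative of the Lyapunov function, with [d = <Z, Y>],
    [q = <Y, e>], [p = <Z, P(Z)>], [z = |Z|] and [y = |e|].  The term [eps q] is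
    split by the arithmetic-geometric mean inequality so that it consumes half
    of [eps y^2]; what is left over in [z^2] is absorbed by [c z^2 / 2]. *)
Lemma lyapunov_dissipation (k c m eps z y d q p : R) : 0 < k -> 0 <= eps ->
  eps * (2 * k + m ^+ 2) <= c -> d <= - (c * z ^+ 2) -> `|q| <= m * z * y ->
  p <= z ^+ 2 ->
  d - eps * (y ^+ 2 + q - k * p) <= - (c / 2 * z ^+ 2 + eps / 2 * y ^+ 2).
Proof.
move=> k_gt0 eps_ge0 eps_le d_le; rewrite ler_norml => /andP[q_ge _] p_le.
have mzy : m * z * y <= (m ^+ 2 * z ^+ 2 + y ^+ 2) / 2.
  by have := sqr_ge0 (m * z - y); rewrite sqrrB exprMn; lra.
have epsq : 0 <= eps * (q + (m ^+ 2 * z ^+ 2 + y ^+ 2) / 2).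
  by rewrite mulr_ge0//; lra.
have epsp : 0 <= eps * (k * (z ^+ 2 - p)).
  by rewrite !mulr_ge0 ?subr_ge0// ltW.
have epsz : eps * (2 * k + m ^+ 2) * z ^+ 2 <= c * z ^+ 2.
  by rewrite ler_wpM2r ?sqr_ge0.
lra.
Qed.

(** The cross term [- eps <Z, e>] is what makes the function decay in [e]: only
    its derivative contains [- |e|^2].  The rate and the constant are chosen
    before the system, hence serve all initial conditions. *)
Lemma error_system_decay (k c m : R) : 0 < k -> 0 < c ->
  exists a K : R, [/\ 0 < a, 0 < K &
    forall n (V : set 'M[R]_n) (Z e Y : R -> 'M[R]_n),
      linear_subspace V ->
      (forall t : R, 0 <= t -> V (e t)) ->
      (forall t : R, 0 <= t -> is_derive t (1 : R) Z (e t + Y t)) ->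
      (forall t : R, 0 <= t ->
        is_derive t (1 : R) e (- (k *: orthogonal_projection V (Z t)))) ->
      (forall t : R, 0 <= t -> mxdot (Z t) (Y t) <= - (c * frobenius (Z t) ^+ 2)) ->
      (forall t : R, 0 <= t -> frobenius (Y t) <= m * frobenius (Z t)) ->
      forall t : R, 0 <= t ->
        frobenius (Z t) ^+ 2 + frobenius (e t) ^+ 2 <=
        K * (frobenius (Z 0) ^+ 2 + frobenius (e 0) ^+ 2) * expR (- (a * t))].
Proof.
move=> k_gt0 c_gt0.
(* The denominator D dominates 2 k + m^2, 2 c and 2 c k, which gives the
   three upper bounds required of eps = c / D. *)
pose D := 2 * k + m ^+ 2 + 2 * c + 2 * c * k.
have m2_ge0 := sqr_ge0 m.
have ck_gt0 : 0 < c * k by exact: mulr_gt0.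
have D_gt0 : 0 < D by rewrite /D; lra.
pose eps := c / D.
have eps_gt0 : 0 < eps by rewrite divr_gt0.
have epsD : eps * D = c by rewrite divfK// gt_eqF.
have eps_rate : eps * (2 * k + m ^+ 2) <= c.
  by rewrite -epsD ler_wpM2l ?(ltW eps_gt0)// /D; lra.
have eps_half : eps <= 2^-1 by rewrite ler_pdivrMr// /D; lra.
have epsk_half : eps * k <= 2^-1 by rewrite mulrAC ler_pdivrMr// /D; lra.
have epsk_gt0 : 0 < eps * k by exact: mulr_gt0.
(* As W <= 3/4 (|Z|^2 + |e|^2 / k), a rate a <= c / 2, a <= eps k / 2 turns the
   dissipation into - a W. *)
pose a := Num.min c (eps * k) / 2.
have a_gt0 : 0 < a by rewrite divr_gt0// lt_min c_gt0.
have a_le_c : 2 * a <= c by rewrite /a mulrC divfK// ge_min lexx.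
have a_le_eps : 2 * a <= eps * k by rewrite /a mulrC divfK// ge_min lexx orbT.
exists a, (4 * (1 + k) * (1 + k^-1)).
have kV_gt0 : 0 < k^-1 by rewrite invr_gt0.
split => //; first by rewrite !mulr_gt0// ltr_wpDl// ltW.
move=> n V Z e Y V_lin Ve Z_der e_der dissip Y_le t t_ge0.
pose W (s : R) := mxdot (Z s) (Z s) / 2 + mxdot (e s) (e s) / k / 2
                  - eps * mxdot (Z s) (e s).
pose P (s : R) := orthogonal_projection V (Z s).
pose dW (s : R) := mxdot (Z s) (Y s) -
   eps * (mxdot (e s) (e s) + mxdot (Y s) (e s) - k * mxdot (Z s) (P s)).
have W_der (s : R) : 0 <= s -> is_derive s (1 : R) W (dW s).
  move=> s_ge0; have Zs := Z_der s s_ge0; have es := e_der s s_ge0.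
  have scale (f : R -> R) (df r : R) : is_derive s (1 : R) f df ->
      is_derive s (1 : R) (fun x => f x * r) (df * r).
    move=> f_der; apply: (is_derive_eq (is_deriveM_fun f_der (is_derive_cst r s 1))).
    by rewrite mulr0 addr0.
  have ZZ := scale _ _ 2^-1 (is_derive_mxdot Zs Zs).
  have ee := scale _ _ 2^-1 (scale _ _ k^-1 (is_derive_mxdot es es)).
  have Ze := scale _ _ eps (is_derive_mxdot Zs es).
  have -> : W = fun x => mxdot (Z x) (Z x) / 2 + mxdot (e x) (e x) / k / 2
                         - mxdot (Z x) (e x) * eps.
    by apply/funext => x; rewrite /W (mulrC eps).
  apply: (is_derive_eq (is_deriveB (is_deriveD ZZ ee) Ze)).
  rewrite /dW -/(P s) !(mxdotDl, mxdotDr, mxdotNl, mxdotNr, mxdotZl, mxdotZr).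
  (* Membership of e in V is used here: the coupling terms between Z and e
     cancel exactly. *)
  have -> : mxdot (P s) (e s) = mxdot (Z s) (e s).
    by apply: mxdot_projection => //; exact: Ve.
  have -> : mxdot (e s) (P s) = mxdot (Z s) (e s).
    by rewrite mxdotC; apply: mxdot_projection => //; exact: Ve.
  rewrite (mxdotC (e s) (Z s)) (mxdotC (Y s) (Z s)).
  by field; rewrite gt_eqF.
have W_equiv (s : R) := lyapunov_equiv k_gt0 (ltW eps_gt0) eps_half epsk_half
  (mxdot_CauchySchwarz (Z s) (e s)).
have WE (s : R) : frobenius (Z s) ^+ 2 / 2 + frobenius (e s) ^+ 2 / k / 2 -
    eps * mxdot (Z s) (e s) = W s by rewrite !sqr_frobenius.
have W_diss (s : R) : 0 <= s -> dW s <= - (a * W s).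
  move=> s_ge0.
  have Ye_le : `|mxdot (Y s) (e s)| <= m * frobenius (Z s) * frobenius (e s).
    rewrite (le_trans (mxdot_CauchySchwarz _ _))// ler_wpM2r ?frobenius_ge0//.
    exact: Y_le.
  have P_le : mxdot (Z s) (P s) <= frobenius (Z s) ^+ 2.
    by rewrite sqr_frobenius; exact: mxdot_projection_le.
  have := lyapunov_dissipation k_gt0 (ltW eps_gt0) eps_rate (dissip s s_ge0) Ye_le P_le.
  rewrite [in X in X <= _ -> _](sqr_frobenius (e s)) -/(dW s) => /le_trans; apply.
  have /andP[_] := W_equiv s; rewrite WE => W_le.
  have aW_le := ler_wpM2l (ltW a_gt0) W_le.
  set z2 := frobenius (Z s) ^+ 2 in aW_le *.
  set y2 := frobenius (e s) ^+ 2 in aW_le *.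
  have z2_ge0 : 0 <= z2 by exact: sqr_ge0.
  pose y' := y2 / k.
  have y2E : y2 = k * y' by rewrite /y' mulrC divfK// gt_eqF.
  have y'_ge0 : 0 <= y' by rewrite divr_ge0 ?sqr_ge0// ltW.
  have z_term : 2 * a * z2 <= c * z2 by rewrite ler_wpM2r.
  have y_term : 2 * a * y' <= eps * k * y' by rewrite ler_wpM2r.
  have az_ge0 : 0 <= a * z2 by rewrite mulr_ge0// ltW.
  have ay_ge0 : 0 <= a * y' by rewrite mulr_ge0// ltW.
  rewrite -/y' in aW_le; rewrite y2E; lra.
have W_decay := exponential_decay W_der W_diss t_ge0.
have x_gt0 := expR_gt0 (- (a * t)); set x := expR _ in W_decay x_gt0 *.
have /andP[W_low _] := W_equiv t; have /andP[_ W_up] := W_equiv 0.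
rewrite !WE in W_low W_up.
have lower : frobenius (Z t) ^+ 2 + frobenius (e t) ^+ 2 <=
    (1 + k) * (frobenius (Z t) ^+ 2 + frobenius (e t) ^+ 2 / k).
  have : k * (frobenius (e t) ^+ 2 / k) = frobenius (e t) ^+ 2.
    by rewrite mulrC divfK// gt_eqF.
  have := mulr_ge0 (ltW k_gt0) (sqr_ge0 (frobenius (Z t))).
  have := mulr_ge0 (sqr_ge0 (frobenius (e t))) (ltW kV_gt0); lra.
have upper : frobenius (Z 0) ^+ 2 + frobenius (e 0) ^+ 2 / k <=
    (1 + k^-1) * (frobenius (Z 0) ^+ 2 + frobenius (e 0) ^+ 2).
  have := mulr_ge0 (ltW kV_gt0) (sqr_ge0 (frobenius (Z 0))).
  have := sqr_ge0 (frobenius (e 0)); lra.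
apply: (le_trans lower).
have k1_gt0 : 0 < 1 + k by rewrite ltr_wpDl.
apply: (@le_trans _ _ ((1 + k) * (4 * (W 0 * x)))).
  by rewrite ler_pM2l//; lra.
have W0_le : W 0 <= (1 + k^-1) * (frobenius (Z 0) ^+ 2 + frobenius (e 0) ^+ 2).
  apply: le_trans W_up (le_trans _ upper).
  have := sqr_ge0 (frobenius (Z 0)).
  have := mulr_ge0 (sqr_ge0 (frobenius (e 0))) (ltW kV_gt0); lra.
have := ler_wpM2r (ltW x_gt0) W0_le => /(ler_wpM2l (ltW k1_gt0)).
lra.
Qed.

End LyapunovDecay.

(** * Convergence of the observer *)

(** Here [B = A^-1] and [Z = 1 - Abar B]; the left side is the derivative of [Z],
    as [B' = B xi].  Passing to [Z] avoids differentiating the inverse of [g]. *)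
Lemma observer_error_dynamics (R : realType) n (xi b bbar Abar A B : 'M[R]_n) (k : R) :
  A *m B = 1%:M ->
  - ((- ((xi + b) *m Abar) + bbar *m A + k *: (A - Abar)) *m B + Abar *m (B *m xi)) =
  (b - bbar) + (- ((xi + b) *m (1%:M - Abar *m B)) - k *: (1%:M - Abar *m B)
                + (1%:M - Abar *m B) *m xi).
Proof.
move=> AB; rewrite mulmxA; set Q := Abar *m B.
have -> : (- ((xi + b) *m Abar) + bbar *m A + k *: (A - Abar)) *m B =
          - ((xi + b) *m Q) + bbar + k *: (1%:M - Q).
  move: (xi + b) => X.
  by rewrite !mulmxDl mulNmx -scalemxAl mulmxBl -!mulmxA AB mulmx1.
rewrite mulmxBr mulmxBl mulmx1 mul1mx.
move: ((xi + b) *m Q) (Q *m xi) => X1 X2.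
by apply/matrixP => i j; rewrite !mxE; ring.
Qed.

(** The terms [<Z, xi Z>], [<Z, b Z>] and [<Z, Z xi>] are bounded separately by
    the norms of [xi], [b] and [xi]; this is where the threshold
    [2 B_xi + B_b] on the gain comes from. *)
Lemma mxdot_error_drift (R : realType) n (xi b Z : 'M[R]_n) (B_xi B_b k : R) :
  frobenius xi <= B_xi -> frobenius b <= B_b ->
  mxdot Z (- ((xi + b) *m Z) - k *: Z + Z *m xi) <=
  - ((k - (2 * B_xi + B_b)) * frobenius Z ^+ 2).
Proof.
move=> xi_le b_le.
have bound (Y : 'M[R]_n) r : frobenius Y <= r * frobenius Z ->
    `|mxdot Z Y| <= r * frobenius Z ^+ 2.
  move=> Y_le; apply: le_trans (mxdot_CauchySchwarz _ _) _.
  by rewrite expr2 mulrCA ler_wpM2l ?frobenius_ge0.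
have mull (X : 'M[R]_n) r : frobenius X <= r -> frobenius (X *m Z) <= r * frobenius Z.
  by move=> X_le; rewrite (le_trans (frobeniusM _ _))// ler_wpM2r ?frobenius_ge0.
have mulr : frobenius (Z *m xi) <= B_xi * frobenius Z.
  by rewrite (le_trans (frobeniusM _ _))// mulrC ler_wpM2r ?frobenius_ge0.
move: (bound _ _ (mull _ _ xi_le)) (bound _ _ (mull _ _ b_le)) (bound _ _ mulr).
rewrite !ler_norml => /andP[xiZ _] /andP[bZ _] /andP[_ Zxi].
rewrite mulmxDl !(mxdotDr, mxdotNr) mxdotZr -sqr_frobenius; lra.
Qed.

Lemma frobenius_error_drift (R : realType) n (xi b Z : 'M[R]_n) (B_xi B_b k : R) :
  0 <= k -> frobenius xi <= B_xi -> frobenius b <= B_b ->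
  frobenius (- ((xi + b) *m Z) - k *: Z + Z *m xi) <= (2 * B_xi + B_b + k) * frobenius Z.
Proof.
move=> k_ge0 xi_le b_le; have Z_ge0 := frobenius_ge0 Z.
have xb_le : frobenius (xi + b) <= B_xi + B_b.
  by rewrite (le_trans (frobeniusD _ _))// lerD.
have Zxi := le_trans (frobeniusM Z xi) (ler_wpM2l Z_ge0 xi_le).
have xbZ := le_trans (frobeniusM (xi + b) Z) (ler_wpM2r Z_ge0 xb_le).
have := frobeniusD (- ((xi + b) *m Z) - k *: Z) (Z *m xi).
have := frobeniusD (- ((xi + b) *m Z)) (- (k *: Z)).
rewrite !frobeniusN frobeniusZ//; lra.
Qed.

Theorem mainTheorem5 (R : realType) (n : nat) (n_gt0 : (0 < n)%N)
  (G : set 'M[R]_n) (G_lie : matrix_lie_group G)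
  (g xi : R -> 'M[R]_n)
  (g_in : forall t : R, 0 <= t -> G (g t))
  (xi_in : forall t : R, 0 <= t -> lie_algebra G (xi t))
  (g_dyn : forall t : R, 0 <= t -> is_derive_ge0 g t (g t *m xi t))
  (A : R -> 'M[R]_n) (F : 'M[R]_n) (F_unit : F \in unitmx)
  (A_def : forall t : R, 0 <= t -> A t = invmx (g t) *m F)
  (xi_m : R -> 'M[R]_n) (b : 'M[R]_n) (b_in : lie_algebra G b)
  (xi_m_def : forall t : R, 0 <= t -> xi_m t = xi t + b)
  (B_xi B_b : R) (B_xi_gt0 : 0 < B_xi) (B_b_gt0 : 0 < B_b)
  (xi_bound : forall t : R, 0 <= t -> frobenius (xi t) <= B_xi)
  (b_bound : frobenius b <= B_b)
  (L_g U_g : R) (L_g_gt0 : 0 < L_g) (U_g_gt0 : 0 < U_g)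
  (g_bound : forall t : R, 0 <= t ->
    [/\ L_g <= sigma_min (g t), sigma_min (g t) <= sigma_max (g t) &
        sigma_max (g t) <= U_g])
  (k_P k_I : R) (k_P_gt : 2 * B_xi + B_b < k_P) (k_I_gt0 : 0 < k_I) :
  exists a C : R, [/\ 0 < a, 0 < C &
    forall Abar bbar : R -> 'M[R]_n,
      (forall t : R, 0 <= t -> lie_algebra G (bbar t)) ->
      (forall t : R, 0 <= t ->
        is_derive_ge0 Abar t
          (- (xi_m t *m Abar t) + bbar t *m A t + k_P *: (A t - Abar t))) ->
      (forall t : R, 0 <= t ->
        is_derive_ge0 bbar t
          (k_I *: orthogonal_projection (lie_algebra G)
                    ((A t - Abar t) *m invmx (A t)))) ->
      forall t : R, 0 <= t ->
        frobenius (A t - Abar t) + frobenius (b - bbar t) <=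
        C * (frobenius (A 0 - Abar 0) + frobenius (b - bbar 0)) *
        expR (- (a * t))].
Proof.
have c_gt0 : 0 < k_P - (2 * B_xi + B_b) by rewrite subr_gt0.
have kP_ge0 : 0 <= k_P by lra.
have [a [K [a_gt0 K_gt0 decay]]] :=
  error_system_decay (2 * B_xi + B_b + k_P) k_I_gt0 c_gt0.
pose rn : R := Num.sqrt n%:R.
have rn_ge0 : 0 <= rn by exact: sqrtr_ge0.
pose alpha := rn / L_g * frobenius F.
pose beta := frobenius (invmx F) * (rn * U_g).
have alpha_ge0 : 0 <= alpha.
  by rewrite mulr_ge0 ?frobenius_ge0// divr_ge0// ltW.
have beta_ge0 : 0 <= beta.
  by rewrite mulr_ge0 ?frobenius_ge0// mulr_ge0// ltW.
have g_unit (t : R) : 0 <= t -> g t \in unitmx.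
  move=> t_ge0; have [G_GL _ _ _ _] := G_lie.
  by rewrite unitmxE unitfE; exact: G_GL (g_in t t_ge0).
have A_le (t : R) : 0 <= t -> frobenius (A t) <= alpha.
  move=> t_ge0; have [L_le _ _] := g_bound t t_ge0.
  rewrite A_def// (le_trans (frobeniusM _ _))// ler_wpM2r ?frobenius_ge0//.
  rewrite ler_pdivlMr// mulrC.
  apply: le_trans (frobenius_inv_le_sigma_min n_gt0 (g_unit t t_ge0)).
  by rewrite ler_wpM2r ?frobenius_ge0.
pose B t := invmx F *m g t.
have B_le (t : R) : 0 <= t -> frobenius (B t) <= beta.
  move=> t_ge0; have [L_le LU U_le] := g_bound t t_ge0.
  rewrite (le_trans (frobeniusM _ _))// ler_wpM2l ?frobenius_ge0//.
  apply: le_trans (frobenius_le_sigma_max n_gt0 _) _; first by lra.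
  by rewrite ler_wpM2l.
have AB (t : R) : 0 <= t -> A t *m B t = 1%:M.
  move=> t_ge0; rewrite A_def// mulmxA -(mulmxA _ F) mulmxV// mulmx1.
  by rewrite mulVmx// g_unit.
have invA (t : R) : 0 <= t -> invmx (A t) = B t.
  move=> t_ge0; have A_unit := (mulmx1_unit (AB t t_ge0)).1.
  by rewrite -[LHS]mulmx1 -(AB t t_ge0) mulKmx.
have [gx gxE gx_der] := is_derive_ge0_extend g_dyn.
exists (a / 2), ((alpha + 1) * (2 * K + 1) * (beta + 1)); split.
- by rewrite divr_gt0.
- by rewrite !mulr_gt0 ?ltr_wpDl// mulr_ge0// ltW.
move=> Abar bbar bbar_in Abar_dyn bbar_dyn t t_ge0.
have [Ax AxE Ax_der] := is_derive_ge0_extend Abar_dyn.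
have [bx bxE bx_der] := is_derive_ge0_extend bbar_dyn.
pose Z s := 1%:M - Ax s *m (invmx F *m gx s).
pose e s := b - bx s.
pose Y s := - ((xi s + b) *m Z s) - k_P *: Z s + Z s *m xi s.
have ZE (s : R) : 0 <= s -> Z s = (A s - Abar s) *m B s.
  by move=> s_ge0; rewrite /Z AxE// gxE// mulmxBl AB.
have eE (s : R) : 0 <= s -> e s = b - bbar s by move=> s_ge0; rewrite /e bxE.
have V_lin := linear_subspace_lie_algebra G_lie.
have e_in (s : R) : 0 <= s -> lie_algebra G (e s).
  move=> s_ge0; have [_ VD VZ] := V_lin; rewrite eE// -scaleN1r.
  by apply: VD => //; apply: VZ; exact: bbar_in.
have Z_der (s : R) : 0 <= s -> is_derive s (1 : R) Z (e s + Y s).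
  move=> s_ge0.
  have Fg := is_derive_mulmx (is_derive_cst (invmx F) s (1 : R)) (gx_der s s_ge0).
  have AFg := is_derive_mulmx (Ax_der s s_ge0) Fg.
  apply: (is_derive_eq (is_deriveB (is_derive_cst (1%:M : 'M[R]_n) s (1 : R)) AFg)).
  rewrite sub0r mul0mx add0r /= gxE// AxE// (mulmxA (invmx F)) -/(B s) xi_m_def//.
  rewrite (observer_error_dynamics _ _ _ _ _ (AB s s_ge0)).
  by rewrite /Y eE// /Z AxE// gxE.
have e_der (s : R) : 0 <= s -> is_derive s (1 : R) e
    (- (k_I *: orthogonal_projection (lie_algebra G) (Z s))).
  move=> s_ge0; rewrite ZE// -invA//.
  apply: (is_derive_eq (is_deriveB (is_derive_cst b s (1 : R)) (bx_der s s_ge0))).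
  by rewrite sub0r.
have Z_drift (s : R) : 0 <= s ->
    mxdot (Z s) (Y s) <= - ((k_P - (2 * B_xi + B_b)) * frobenius (Z s) ^+ 2).
  by move=> s_ge0; exact: mxdot_error_drift (xi_bound s s_ge0) b_bound.
have Y_le (s : R) : 0 <= s -> frobenius (Y s) <= (2 * B_xi + B_b + k_P) * frobenius (Z s).
  by move=> s_ge0; exact: frobenius_error_drift kP_ge0 (xi_bound s s_ge0) b_bound.
have {decay} := decay n _ Z e Y V_lin e_in Z_der e_der Z_drift Y_le t t_ge0.
rewrite -!eE//.
set x := expR (- (a / 2 * t)).
have x_gt0 : 0 < x by exact: expR_gt0.
have -> : expR (- (a * t)) = x ^+ 2.
  by rewrite -expRM_natl; congr expR; lra.
move=> decay.
have Z_ge0 s := frobenius_ge0 (Z s); have e_ge0 s := frobenius_ge0 (e s).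
have E_ge0 s := frobenius_ge0 (A s - Abar s).
have E_le : frobenius (A t - Abar t) <= alpha * frobenius (Z t).
  have -> : A t - Abar t = Z t *m A t.
    by rewrite ZE// -mulmxA (mulmx1C (AB t t_ge0)) mulmx1.
  by rewrite (le_trans (frobeniusM _ _))// mulrC ler_wpM2r// A_le.
have Z0_le : frobenius (Z 0) <= beta * frobenius (A 0 - Abar 0).
  by rewrite ZE// (le_trans (frobeniusM _ _))// mulrC ler_wpM2r// B_le.
pose N0 := frobenius (Z 0) + frobenius (e 0).
have N0_ge0 : 0 <= N0 by rewrite addr_ge0.
(* The decay of the squares yields the decay of the sum, using
   (z + y)^2 <= 2 (z^2 + y^2) and 2 K <= (2 K + 1)^2. *)
have Nt_le : frobenius (Z t) + frobenius (e t) <= (2 * K + 1) * N0 * x.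
  have K1_ge0 : 0 <= 2 * K + 1 by lra.
  have rhs_ge0 : 0 <= (2 * K + 1) * N0 * x by rewrite !mulr_ge0// ltW.
  rewrite -ler_sqr ?nnegrE ?addr_ge0//.
  apply: (@le_trans _ _ (2 * K * N0 ^+ 2 * x ^+ 2)).
    apply: (@le_trans _ _ (2 * (frobenius (Z t) ^+ 2 + frobenius (e t) ^+ 2))).
      by have := sqr_ge0 (frobenius (Z t) - frobenius (e t)); rewrite sqrrB sqrrD; lra.
    have -> : 2 * K * N0 ^+ 2 * x ^+ 2 = 2 * (K * N0 ^+ 2 * x ^+ 2) by ring.
    rewrite ler_pM2l//; apply: le_trans decay _.
    rewrite ler_wpM2r ?sqr_ge0// ler_wpM2l ?(ltW K_gt0)// /N0 sqrrD.
    by have := mulr_ge0 (Z_ge0 0) (e_ge0 0); lra.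
  rewrite !exprMn !ler_wpM2r ?sqr_ge0// sqrrD.
  by have := sqr_ge0 (2 * K); lra.
have N0_le : N0 <= (beta + 1) * (frobenius (A 0 - Abar 0) + frobenius (e 0)).
  have := mulr_ge0 beta_ge0 (e_ge0 0); have := E_ge0 0; rewrite /N0; lra.
apply: (@le_trans _ _ ((alpha + 1) * (frobenius (Z t) + frobenius (e t)))).
  by have := mulr_ge0 alpha_ge0 (e_ge0 t); have := Z_ge0 t; lra.
rewrite -!mulrA ler_pM2l ?ltr_wpDl//.
apply: le_trans Nt_le _; rewrite -!mulrA ler_pM2l; last by lra.
by rewrite mulrA ler_wpM2r// ltW.
Qed.
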